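(* Let $P$ be a regular (resp. colored regular) set of forbidden patterns whose succession function $\chi_P$ can be evaluated in constant time, and suppose $P$ contains no pattern of the form $\tau(1)\tau(2)\cdots\tau(k-2)\,k\,(k-1)$ with $k\ge2$ (i.e. no length-$k$ pattern ending with $k$ followed by $k-1$). Then, for every $n\ge0$, the generating algorithm Gen_Avoid (resp. its colored version) described below lists each permutation of $S_n(P)$ exactly once and runs in constant amortized time, i.e. its total running time is $O(|S_n(P)|)$.
   Context: Patterns and avoidance: a permutation contains $\sigma$ if some subsequence is order-isomorphic to $\sigma$; $S_n(P)$ is the set of permutations of $\{1,\dots,n\}$ avoiding all patterns of $P$, $S(P)=\bigcup_n S_n(P)$, $S_0(P)=\{\epsilon\}$. Sites of a length-$n$ permutation are its $n+1$ gaps numbered from right to left (site $1$ after the last entry; $\epsilon$ has one site); $\alpha^{\downarrow i}$ inserts $n+1$ into site $i$ of $\alpha\in S_n$; site $i$ of $\alpha\in S_n(P)$ is active if $\alpha^{\downarrow i}\in S_{n+1}(P)$. $P$ is right-justified if moving the largest entry of any $\alpha\in S(P)$ one position right (when possible) stays in $S(P)$. A right-justified $P$ is regular if every $\alpha\in S(P)$ has site 1 active and, when $\alpha$ has $k$ active sites, for $1\le i\le k$ the number of active sites of $\alpha^{\downarrow i}$ depends only on $(i,k)$, denoted $\chi_P(i,k)$. It is colored regular if there is an integer coloring of $S(P)$ with $\epsilon$ colored $0$ such that every $\alpha\in S(P)$ has site 1 active and, when $\alpha$ has $k$ active sites and color $c$, for $1\le i\le k$ the number of active sites and the color of $\alpha^{\downarrow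 i}$ depend only on $(i,k,c)$; this pair is denoted $\chi_P(i,k,c)$. Algorithm (regular case): a global array $\alpha$ initially empty; recursive procedure Gen_Avoid$(\ell,k)$: if $\ell=n$, output $\alpha$; otherwise set $\ell:=\ell+1$, append the value $\ell$ at the end of $\alpha$ (giving the old $\alpha$ with $\ell$ inserted in site 1), call Gen_Avoid$(\ell,\chi_P(1,k))$; then for $i=2,\dots,k$, swap the entries of $\alpha$ in positions $\ell-i+2$ and $\ell-i+1$ (moving $\ell$ one step left, i.e. into site $i$) and call Gen_Avoid$(\ell,\chi_P(i,k))$; finally, for $i=k$ down to $2$ swap positions $\ell-i+2$ and $\ell-i+1$ again to restore $\alpha$. Initial call Gen_Avoid$(0,1)$. Colored version: Gen_Avoid$(\ell,k,c)$ is identical except that the recursive call for site $i$ is Gen_Avoid$(\ell,u,v)$ with $(u,v)=\chi_P(i,k,c)$; initial call Gen_Avoid$(0,1,0)$. Constant amortized time means the total computation divided by the number of generated objects is $O(1)$. *)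

(* Defs.v *)
From mathcomp Require Import all_boot ssralg ssrint.
From mathcomp Require Import boolp classical_sets.

Set Implicit Arguments.
Unset Strict Implicit.
Unset Printing Implicit Defensive.

(* A permutation of {1, .., n} is the word of its values, that is, a           *)
(* rearrangement of iota 1 n.                                                 *)

Definition order_iso (s t : seq nat) : Prop :=
  size s = size t /\
  forall i j, i < size s -> j < size s ->
    (nth 0 s i < nth 0 s j) = (nth 0 t i < nth 0 t j).

Definition contains (s sigma : seq nat) : Prop :=
  exists2 t, subseq t s & order_iso t sigma.

Definition avoids (P : set (seq nat)) (s : seq nat) : Prop :=
  forall sigma, P sigma -> ~ contains s sigma.

(* Patterns are nonempty, so that the empty permutation avoids P.             *)
Definition pattern_set (P : set (seq nat)) : Prop :=
  forall sigma, P sigma ->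
    sigma != [::] /\ perm_eq sigma (iota 1 (size sigma)).

(* S_n(P), as a duplicate-free list *)
Definition avoiders (P : set (seq nat)) (n : nat) : seq (seq nat) :=
  [seq a <- permutations (iota 1 n) | `[< avoids P a >]].

(* Site i has i - 1 entries to its right.                                     *)
Definition insert (a : seq nat) (i : nat) : seq nat :=
  take (size a - i.-1) a ++ (size a).+1 :: drop (size a - i.-1) a.

Definition active (P : set (seq nat)) (a : seq nat) (i : nat) : bool :=
  (1 <= i <= (size a).+1) && (insert a i \in avoiders P (size a).+1).

Definition nb_active (P : set (seq nat)) (a : seq nat) : nat :=
  count (active P a) (iota 1 (size a).+1).

Definition right_justified (P : set (seq nat)) : Prop :=
  forall n u x v, u ++ [:: n, x & v] \in avoiders P n ->
    u ++ [:: x, n & v] \in avoiders P n.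

(* P is regular, with succession function chi; only the values chi i k such   *)
(* that 1 <= i <= k and k is the number of active sites of a permutation in   *)
(* S(P) are constrained.                                                      *)
Definition regular (P : set (seq nat)) (chi : nat -> nat -> nat) : Prop :=
  right_justified P /\
  forall n a, a \in avoiders P n ->
    active P a 1 /\
    forall i, 1 <= i <= nb_active P a ->
      nb_active P (insert a i) = chi i (nb_active P a).

Definition colored_regular (P : set (seq nat)) (color : seq nat -> int)
    (chi : nat -> nat -> int -> nat * int) : Prop :=
  [/\ right_justified P,
      color [::] = 0%R
    & forall n a, a \in avoiders P n ->
        active P a 1 /\
        forall i, 1 <= i <= nb_active P a ->
          (nb_active P (insert a i), color (insert a i))
            = chi i (nb_active P a) (color a)].

(* t i k (resp. t i k c) is the time taken to evaluate chi at (i, k) (resp.   *)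
(* (i, k, c)); it is bounded on the domain of the succession function.        *)
Definition constant_time (P : set (seq nat)) (t : nat -> nat -> nat) : Prop :=
  exists K, forall n a i, a \in avoiders P n ->
    1 <= i <= nb_active P a -> t i (nb_active P a) <= K.

Definition colored_constant_time (P : set (seq nat)) (color : seq nat -> int)
    (t : nat -> nat -> int -> nat) : Prop :=
  exists K, forall n a i, a \in avoiders P n ->
    1 <= i <= nb_active P a -> t i (nb_active P a) (color a) <= K.

(* The running time counts every elementary operation, each kind of           *)
(* operation having a fixed cost. As is usual for generating algorithms,      *)
(* "output" hands over the current array at a fixed cost.                     *)
Record costs := Costs {
  cost_call : nat;    (* procedure call and return, test l = n *)
  cost_output : nat;
  cost_incr : nat;
  cost_write : nat;   (* assignment of an array cell *)
  cost_swap : nat;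
  cost_test : nat     (* update and bound test of a loop counter *)
}.

Record state := State {
  array : seq nat;
  output : seq (seq nat);
  time : nat
}.

Definition tick (c : nat) (st : state) : state :=
  State (array st) (output st) (time st + c).

Section GenAvoid.

Variable C : costs.

Definition emit (st : state) : state :=
  tick (cost_output C)
    (State (array st) (rcons (output st) (array st)) (time st)).

(* Array positions are numbered from 1. The array is extended if p is one     *)
(* more than its size.                                                        *)
Definition write (p v : nat) (st : state) : state :=
  tick (cost_write C)
    (State (set_nth 0 (array st) p.-1 v) (output st) (time st)).

Definition swap (p q : nat) (st : state) : state :=
  let a := array st in
  tick (cost_swap C)
    (State (set_nth 0 (set_nth 0 a p.-1 (nth 0 a q.-1)) q.-1 (nth 0 a p.-1))
       (output st) (time st)).

(* The first tick pays for the test that exits the loop.                      *)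
Definition for_loop (range : seq nat) (body : nat -> state -> state)
    (st : state) : state :=
  foldl (fun st i => body i (tick (cost_test C) st))
    (tick (cost_test C) st) range.

(* A node of the generating tree carries a label x of type L: the number k of *)
(* active sites in the regular case, (k, c) with c the color in the colored   *)
(* case. [child i x] is the label of the i-th child, and [t i x] the time     *)
(* taken to compute it. The recursion is on d = n - l, so the test l = n is   *)
(* d = 0. Appending l to the l-1 current entries is the assignment of cell l, *)
(* which may hold a stale value left there by a previous call.                *)
Fixpoint gen_avoid_rec (L : Type) (sites : L -> nat) (child : nat -> L -> L)
    (t : nat -> L -> nat) (d l : nat) (x : L) (st : state) : state :=
  let st := tick (cost_call C) st in
  if d is d'.+1 then
    let k := sites x in
    let l := l.+1 in
    let st := tick (cost_incr C) st in
    let visit i st :=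
      gen_avoid_rec sites child t d' l (child i x) (tick (t i x) st) in
    let st := write l l st in
    let st := visit 1 st in
    let st := for_loop (iota 2 k.-1)
      (fun i st => visit i (swap (l - i + 2) (l - i + 1) st)) st in
    for_loop (rev (iota 2 k.-1))
      (fun i st => swap (l - i + 2) (l - i + 1) st) st
  else emit st.

Definition gen_avoid (chi : nat -> nat -> nat) (t : nat -> nat -> nat)
    (n : nat) : state :=
  gen_avoid_rec id chi t n 0 1 (State [::] [::] 0).

Definition gen_avoid_colored (chi : nat -> nat -> int -> nat * int)
    (t : nat -> nat -> int -> nat) (n : nat) : state :=
  gen_avoid_rec fst (fun i x => chi i x.1 x.2) (fun i x => t i x.1 x.2)
    n 0 (1, 0%R : int) (State [::] [::] 0).

End GenAvoid.

(* run n is the final state of the algorithm for length n.                    *)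
Definition generates_in_CAT (P : set (seq nat)) (run : nat -> state) : Prop :=
  (forall n, perm_eq (output (run n)) (avoiders P n)) /\
  (exists K, forall n, time (run n) <= K * size (avoiders P n)).

(* Main.v *)
(** Right-justification makes the active sites of an avoider an initial segment
    1, .., k of the sites, so the recursion tree of the algorithm is the tree in
    which the children of a permutation are its insertions of a new maximum into
    an active site. The work at a node is proportional to 1 plus its number of
    children, so the running time is proportional to the size of the tree. If
    b m with m the maximum avoids P, then so does b (m+1) m, since an occurrence
    of a pattern using both m+1 and m would end with k (k-1). Hence the first
    child of every node has at least two children. Since every node has a child,
    each level is at least twice as large as the second level above it, and the
    leaves form a constant proportion of the tree. *)

Require Import Defs.
From mathcomp Require Import all_boot ssralg ssrint.
From mathcomp Require Import zify.
From mathcomp Require Import boolp classical_sets.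

Set Implicit Arguments.
Unset Strict Implicit.
Unset Printing Implicit Defensive.

(** * Intervals, subsequences and order isomorphism *)

Lemma iota_rcons m n : iota m n.+1 = rcons (iota m n) (m + n).
Proof. by rewrite -addn1 iotaD cats1. Qed.

(** If [p] holds at the last point, it descends to the whole interval, and the count is the length;
    if not, the last point does not change the count. Applied to active sites, this makes them an
    initial segment. *)
Lemma downward_count_iota (p : pred nat) (n : nat) :
  (forall i, 1 <= i -> p i.+1 -> p i) ->
  {in iota 1 n, forall i, p i = (i <= count p (iota 1 n))}.
Proof.
move=> p_down; elim: n => // n IHn i.
rewrite iota_rcons -cats1 mem_cat count_cat /= add1n addn0 inE.
case: (boolP (p n.+1)) => [pn | npn].
  have pall j : j <= n -> p (n.+1 - j).
    elim: j => [|j IHj] ltjn; first by rewrite subn0.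
    apply: p_down; first lia.
    have -> : (n.+1 - j.+1).+1 = n.+1 - j by lia.
    by apply: IHj; lia.
  have : all p (iota 1 n).
    apply/allP => j; rewrite mem_iota => hj.
    have -> : j = n.+1 - (n.+1 - j) by lia.
    by apply: pall; lia.
  rewrite all_count => /eqP ->; rewrite size_iota mem_iota => hi.
  have -> : i <= n + 1 by lia.
  have -> : i = n.+1 - (n.+1 - i) by lia.
  by apply: pall; lia.
rewrite addn0 => /orP [/IHn //|/eqP ->].
have := count_size p (iota 1 n); rewrite size_iota (negbTE npn); lia.
Qed.

Lemma uniq_flatten_map (S T : eqType) (f : S -> seq T) (s : seq S) :
  uniq s -> {in s, forall x, uniq (f x)} ->
  {in s &, forall x y z, z \in f x -> z \in f y -> x = y} ->
  uniq (flatten [seq f x | x <- s]).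
Proof.
elim: s => //= x s IHs /andP [xs us] uf dj; rewrite cat_uniq.
rewrite uf ?mem_head // IHs //; last 2 first.
- by move=> y ys; apply: uf; rewrite inE ys orbT.
- by move=> y z ys zs; apply: dj; rewrite inE ?ys ?zs orbT.
rewrite andbT; apply/hasPn => z /flatten_mapP [y ys zy].
apply/negP => zx; case/negP: xs.
by rewrite (dj x y _ _ z zx zy) // inE ?eqxx // ys orbT.
Qed.

Lemma order_iso_trans s t u : order_iso s t -> order_iso t u -> order_iso s u.
Proof.
by case=> st h [tu h']; split=> [|i j hi hj]; rewrite ?st // h // h' // -st.
Qed.

(** Comparisons with a strict maximum do not depend on its value. *)
Lemma order_iso_rcons_max s m n :
  all (gtn m) s -> all (gtn n) s -> order_iso (rcons s m) (rcons s n).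
Proof.
move=> /allP sm /allP sn; split=> [|i j]; rewrite ?size_rcons //.
have nthE v k : k < (size s).+1 ->
    nth 0 (rcons s v) k = if k < size s then nth 0 s k else v.
  by rewrite nth_rcons ltnS; case: (ltngtP k (size s)).
move=> hi hj; rewrite !nthE //.
have lt_m k : k < size s -> nth 0 s k < m by move/(mem_nth 0)/sm.
have lt_n k : k < size s -> nth 0 s k < n by move/(mem_nth 0)/sn.
case: (ltnP i (size s)) => hi'; case: (ltnP j (size s)) => hj' //.
- by rewrite lt_m // lt_n.
- by have := lt_m _ hj'; have := lt_n _ hj'; lia.
by rewrite !ltnn.
Qed.

Lemma subseq_catE (T : eqType) (t u v : seq T) : subseq t (u ++ v) ->
  exists t1 t2, [/\ t = t1 ++ t2, subseq t1 u & subseq t2 v].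
Proof.
case/subseqP => m sm ->; rewrite -(cat_take_drop (size u) m).
have su : size (take (size u) m) = size u.
  by rewrite size_takel // sm size_cat leq_addr.
by rewrite mask_cat //; do 2!eexists; split; [by [] | exact: mask_subseq..].
Qed.

(** * Insertion of a new maximum into a site *)

Lemma insert_cat u v :
  insert (u ++ v) (size v).+1 = u ++ (size (u ++ v)).+1 :: v.
Proof.
by rewrite /insert /= {1 3}size_cat addnK take_size_cat // drop_size_cat.
Qed.

Lemma size_insert a i : size (insert a i) = (size a).+1.
Proof. by rewrite size_cat /= addnS -size_cat cat_take_drop. Qed.

Lemma insert1 a : insert a 1 = rcons a (size a).+1.
Proof. by rewrite /insert subn0 take_size drop_size cats1. Qed.

(** Sites [i] and [i.+1] lie on the two sides of a single entry [x]. This form fits both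
    right-justification and the swaps of the algorithm. *)
Lemma insert_adjacent a i : 1 <= i <= size a ->
  exists u x v, [/\ a = u ++ x :: v, size v = i.-1,
    insert a i = u ++ [:: x, (size a).+1 & v] &
    insert a i.+1 = u ++ [:: (size a).+1, x & v]].
Proof.
move=> hi; have hlt : size a - i < size a by lia.
pose u := take (size a - i) a; pose v := drop (size a - i).+1 a.
have aE : a = u ++ nth 0 a (size a - i) :: v.
  by rewrite -drop_nth // cat_take_drop.
have sv : size v = i.-1 by rewrite size_drop; lia.
exists u, (nth 0 a (size a - i)), v; split=> //; set x := nth _ _ _ in aE *.
  have -> : i = (size v).+1 by lia.
  by rewrite {1 2}aE -cat_rcons insert_cat cat_rcons.
have -> : i.+1 = (size (x :: v)).+1 by rewrite /= sv; lia.
by rewrite {1 2}aE insert_cat.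
Qed.

(** * Avoiders and their active sites *)

Section Avoiders.

Variable P : set (seq nat).

Lemma mem_avoiders n a :
  (a \in avoiders P n) = perm_eq a (iota 1 n) && `[< avoids P a >].
Proof. by rewrite mem_filter mem_permutations andbC. Qed.

Lemma avoider_size n a : a \in avoiders P n -> size a = n.
Proof.
by rewrite mem_avoiders => /andP [/perm_size -> _]; rewrite size_iota.
Qed.

Lemma avoider_all n a : a \in avoiders P n -> all (geq n) a.
Proof.
rewrite mem_avoiders => /andP [/perm_all -> _].
by apply/allP => i; rewrite mem_iota /=; lia.
Qed.

Lemma avoids_subseq s t : subseq s t -> avoids P t -> avoids P s.
Proof.
move=> st avt sigma Ps [u us iso]; apply: (avt sigma Ps).
by exists u => //; apply: subseq_trans us st.
Qed.

(** Keeping the values up to [n] gives the ancestor of [b] at level [n] of the generating tree. *)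
Lemma avoider_filter n d b : b \in avoiders P (n + d) ->
  [seq x <- b | x <= n] \in avoiders P n.
Proof.
rewrite !mem_avoiders => /andP [bi /asboolP avb]; apply/andP; split.
  rewrite -[X in perm_eq _ X](@filter_iota_ltn 1 (n + d) n) ?leq_addr //.
  exact: perm_filter.
by apply/asboolP/(avoids_subseq (filter_subseq _ _) avb).
Qed.

Lemma nil_avoider : pattern_set P -> [::] \in avoiders P 0.
Proof.
move=> hP; rewrite mem_avoiders perm_refl; apply/asboolP => sigma Ps [t].
rewrite subseq0 => /eqP -> [ss _].
by have [/eqP[]] := hP _ Ps; apply/size0nil; rewrite -ss.
Qed.

Lemma active_insert n a i : a \in avoiders P n -> active P a i ->
  insert a i \in avoiders P n.+1.
Proof. by move=> /avoider_size <- /andP[]. Qed.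

Lemma filter_insert n a i : a \in avoiders P n ->
  [seq x <- insert a i | x <= n] = a.
Proof.
move=> ha; rewrite filter_cat /= (avoider_size ha) ltnn -filter_cat.
by rewrite cat_take_drop; apply/all_filterP/(avoider_all ha).
Qed.

(** The position of the new maximum determines the site. *)
Lemma insert_inj n a : a \in avoiders P n ->
  {in iota 1 n.+1 &, injective (insert a)}.
Proof.
move=> ha; have sa := avoider_size ha.
have idx i : i \in iota 1 n.+1 -> index n.+1 (insert a i) = n - i.-1.
  rewrite mem_iota => hi; rewrite index_cat sa ifN /= ?eqxx ?addn0.
    by rewrite size_takel // sa leq_subr.
  apply/negP => /mem_take /(allP (avoider_all ha)) /=; lia.
move=> i j hi hj /(congr1 (index n.+1)); rewrite !idx // => hij.
by move: hi hj; rewrite !mem_iota; lia.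
Qed.

(** Split [b] at its maximum: the other entries form the parent, and the number of entries to the
    right gives the site. *)
Lemma avoider_insert n b : b \in avoiders P n.+1 ->
  exists2 i, active P [seq x <- b | x <= n] i
           & b = insert [seq x <- b | x <= n] i.
Proof.
move=> hb; have := hb; rewrite mem_avoiders => /andP [bi _].
have ub : uniq b by rewrite (perm_uniq bi) iota_uniq.
have ha : [seq x <- b | x <= n] \in avoiders P n.
  by apply: (@avoider_filter n 1); rewrite addn1.
have nb : n.+1 \in b by rewrite (perm_mem bi) mem_iota; lia.
have allb x : x \in b -> x != n.+1 -> x <= n.
  by rewrite (perm_mem bi) mem_iota; lia.
have [u [v bE]] : exists u v, b = u ++ n.+1 :: v.
  by case/splitPr: nb => u v; exists u, v.
move: ub; rewrite [X in uniq X]bE cat_uniq /= negb_or => /and3P [_ /andP [nu _] /andP [nv _]].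
have aE : [seq x <- b | x <= n] = u ++ v.
  rewrite bE filter_cat /= ltnn; congr (_ ++ _); apply/all_filterP/allP => x hx.
    by apply: allb; [rewrite bE mem_cat hx | apply: contraNneq nu => <-].
  apply: allb; first by rewrite bE mem_cat inE hx !orbT.
  by apply: contraNneq nv => <-.
have bi' : b = insert [seq x <- b | x <= n] (size v).+1.
  by rewrite aE insert_cat -aE (avoider_size ha).
exists (size v).+1 => //; rewrite /active -bi' (avoider_size ha) hb andbT.
by have := avoider_size ha; rewrite aE size_cat => <-; apply: leq_addl.
Qed.

Lemma active_downward n a i : right_justified P -> a \in avoiders P n ->
  1 <= i -> active P a i.+1 -> active P a i.
Proof.
move=> rj ha i1 /andP [hi].
have [|u [x [v [aE sv E1 E2]]]] := @insert_adjacent a i; first lia.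
rewrite E2 /active E1 => /rj ->; rewrite andbT; lia.
Qed.

Lemma nb_active_le a : nb_active P a <= (size a).+1.
Proof. by rewrite -[X in _ <= X](size_iota 1) count_size. Qed.

Lemma activeE n a i : right_justified P -> a \in avoiders P n ->
  active P a i = (1 <= i <= nb_active P a).
Proof.
move=> rj ha; have [hi|hi] := boolP (i \in iota 1 (size a).+1).
  rewrite (@downward_count_iota (active P a) (size a).+1) //.
    by move: hi; rewrite mem_iota => /andP [-> _].
  by move=> j; apply: active_downward rj ha.
rewrite mem_iota add1n ltnS in hi; rewrite /active (negbTE hi) /=.
apply/esym/negbTE; apply: contra hi => /andP [-> le_i] /=.
exact: leq_trans le_i (nb_active_le a).
Qed.

Lemma nb_active_nil : active P [::] 1 -> nb_active P [::] = 1.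
Proof. by rewrite /nb_active /= => ->. Qed.

(** Site 2 of [insert a 1] is shown active, by splitting a supposed occurrence of a pattern into a
    part inside [a] and a part inside the two new entries. *)
Lemma nb_active_insert1 n a : pattern_set P ->
  (forall tau, ~ P (tau ++ [:: (size tau).+2; (size tau).+1])) ->
  right_justified P ->
  (forall n a, a \in avoiders P n -> active P a 1) ->
  a \in avoiders P n -> 1 < nb_active P (insert a 1).
Proof.
move=> hP hend rj act1 ha; have sa := avoider_size ha.
have hb : insert a 1 \in avoiders P n.+1 by apply: active_insert ha (act1 _ _ ha).
suff : active P (insert a 1) 2 by rewrite (activeE _ rj hb).
rewrite /active size_insert sa /=.
have -> : insert (insert a 1) 2 = a ++ [:: n.+2; n.+1].
  by rewrite insert1 -cats1 (@insert_cat a [:: _]) size_cat sa addn1.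
rewrite insert1 sa in hb; move: hb; rewrite !mem_avoiders.
move=> /andP [pb /asboolP avb]; apply/andP; split.
  rewrite (perm_catCA a [:: n.+2] [:: n.+1]) cats1.
  by rewrite iota_rcons add1n perm_sym perm_rcons perm_cons perm_sym.
apply/asboolP => sigma Ps [t /subseq_catE [t1 [t2 [-> s1 s2]]] iso].
have max1 m : n < m -> all (gtn m) t1.
  move=> nm; apply/allP => x /(mem_subseq s1) /(allP (avoider_all ha)) /=; lia.
have notb s : subseq s (rcons a n.+1) -> ~ order_iso s sigma.
  by move=> ss si; apply: (avb _ Ps); exists s.
have : t2 \in [:: [::]; [:: n.+2]; [:: n.+1]; [:: n.+2; n.+1]].
  case/subseqP: s2 => -[|b1 [|b2 []]] //= _ ->.
  by case: b1; case: b2; rewrite !inE eqxx ?orbT.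
rewrite !inE => /or4P [] /eqP t2E; rewrite {t2 s2}t2E in iso.
- by apply: (notb _ _ iso); rewrite -cats1 cat_subseq.
(* Replacing n+2 by n+1 moves the occurrence into [insert a 1], which avoids [P]. *)
- apply: (notb (rcons t1 n.+1)); first by rewrite -!cats1 cat_subseq.
  apply: order_iso_trans iso; rewrite cats1.
  by apply: order_iso_rcons_max; apply: max1.
- by apply: (notb _ _ iso); rewrite -cats1 cat_subseq.
(* Both new entries are used: [sigma] then ends with a descent lying above all its other values. *)
have [/= ssig hiso] := iso; have [_ psig] := hP _ Ps.
pose tau := take (size t1) sigma.
have stau : size tau = size t1 by rewrite size_takel // -ssig size_cat leq_addr.
have [x [y sE]] : exists x y, sigma = tau ++ [:: x; y].
  have : size (drop (size t1) sigma) = 2 by rewrite size_drop -ssig size_cat /=; lia.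
  have := cat_take_drop (size t1) sigma.
  by case: (drop _ _) => [|x [|y []]] // E _; exists x, y.
have szs : size sigma = (size tau).+2 by rewrite sE size_cat /= addn2.
have lt_iso := hiso _ _; rewrite size_cat /= -stau addn2 in lt_iso.
have nt2 : nth 0 (t1 ++ [:: n.+2; n.+1]) (size tau) = n.+2.
  by rewrite nth_cat stau ltnn subnn.
have nt1 : nth 0 (t1 ++ [:: n.+2; n.+1]) (size tau).+1 = n.+1.
  by rewrite nth_cat stau ltnNge leqnSn /= subSnn.
have ns2 : nth 0 sigma (size tau) = x by rewrite sE nth_cat ltnn subnn.
have ns1 : nth 0 sigma (size tau).+1 = y.
  by rewrite sE nth_cat ltnNge leqnSn /= subSnn.
have ltyx : y < x.
  have := lt_iso (size tau).+1 (size tau) (ltnSn _) (leqnSn _).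
  by rewrite nt1 nt2 ns1 ns2 ltnSn => <-.
have lttau z : z \in tau -> z < y.
  move=> zt; have hz : index z tau < size tau by rewrite index_mem.
  have := lt_iso (index z tau) (size tau).+1 (leqW (leqW hz)) (ltnSn _).
  rewrite nt1 ns1 nth_cat -stau hz sE nth_cat hz nth_index // => <-.
  have /(allP (max1 n.+1 (ltnSn n))) // : nth 0 t1 (index z tau) \in t1.
  by rewrite mem_nth // -stau.
have memE z : (z \in tau) || (z == x) || (z == y) = (1 <= z <= (size tau).+2).
  have : (z \in sigma) = (1 <= z <= (size tau).+2).
    by rewrite (perm_mem psig) szs mem_iota.
  by rewrite {1}sE mem_cat !inE orbA.
(* The values of [sigma] fill an interval starting at 1, which forces its two largest ones. *)
have xE : x = (size tau).+2.
  have := memE x; have := memE (size tau).+2; rewrite eqxx orbT leqnn /=.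
  by case/orP=> [/orP [/lttau|]|]; lia.
have yE : y = (size tau).+1.
  have := memE y; have := memE (size tau).+1; rewrite eqxx orbT leqnSn /=.
  by case/orP=> [/orP [/lttau|]|]; lia.
by apply: (hend tau); rewrite -[X in [:: X; _]]xE -yE -sE.
Qed.

(** * The generating tree: its levels and its number of nodes *)

Fixpoint descendants (d : nat) (a : seq nat) : seq (seq nat) :=
  if d is d'.+1 then
    flatten [seq descendants d' (insert a i) | i <- iota 1 (nb_active P a)]
  else [:: a].

(** This will count the calls of the procedure started at [a] with [d] levels to go. *)
Fixpoint nb_nodes (d : nat) (a : seq nat) : nat :=
  if d is d'.+1 then
    (sumn [seq nb_nodes d' (insert a i) | i <- iota 1 (nb_active P a)]).+1
  else 1.

Hypothesis rj : right_justified P.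

Lemma child_avoider n a i : a \in avoiders P n ->
  i \in iota 1 (nb_active P a) -> insert a i \in avoiders P n.+1.
Proof.
move=> ha; rewrite mem_iota add1n ltnS -(activeE _ rj ha).
exact: active_insert.
Qed.

(** The restriction of [b] to the values up to n+1 is the child of [a] through which [b] is
    reached. *)
Lemma mem_descendants d n a b : a \in avoiders P n ->
  (b \in descendants d a) =
  (b \in avoiders P (n + d)) && ([seq x <- b | x <= n] == a).
Proof.
elim: d n a => [|d IHd] n a ha /=.
  rewrite addn0 mem_seq1; apply/eqP/andP => [->|[hb /eqP <-]].
    by split=> //; apply/eqP/all_filterP/(avoider_all ha).
  by apply/esym/all_filterP/(avoider_all hb).
apply/flatten_mapP/andP => [[i hi]|[hb /eqP aE]].
  have hc := child_avoider ha hi.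
  rewrite (IHd _ _ hc) addSnnS => /andP [-> /eqP cE]; split=> //.
  rewrite -(filter_insert i ha) -cE -filter_predI; apply/eqP/eq_filter => x /=.
  by case: leqP => //= /leqW ->.
have hc : [seq x <- b | x <= n.+1] \in avoiders P n.+1.
  by apply: (@avoider_filter _ d); rewrite addSnnS.
have cE : [seq x <- [seq x <- b | x <= n.+1] | x <= n] = a.
  rewrite -filter_predI -aE; apply: eq_filter => x /=.
  by case: leqP => //= /leqW ->.
have [i hi iE] := avoider_insert hc; rewrite cE in hi iE.
rewrite (activeE _ rj ha) in hi.
exists i; first by rewrite mem_iota add1n ltnS.
by rewrite (IHd n.+1) -?iE ?hc // addSnnS hb eqxx.
Qed.

(** A descendant common to two children determines both by restriction, and insertion is
    injective. *)
Lemma uniq_descendants d n a : a \in avoiders P n -> uniq (descendants d a).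
Proof.
elim: d n a => //= d IHd n a ha; apply: uniq_flatten_map => [|i hi|i j hi hj b].
- exact: iota_uniq.
- exact: IHd (child_avoider ha hi).
rewrite !(@mem_descendants d n.+1) ?child_avoider //.
move=> /andP [_ /eqP -> ] /andP [_ /eqP ij].
have sub k : k \in iota 1 (nb_active P a) -> k \in iota 1 n.+1.
  have := nb_active_le a; rewrite (avoider_size ha) !mem_iota !add1n !ltnS.
  by move=> le_n /andP [-> /leq_trans ->].
exact: insert_inj ha _ _ (sub _ hi) (sub _ hj) ij.
Qed.

Lemma perm_descendants_nil n : pattern_set P ->
  perm_eq (descendants n [::]) (avoiders P n).
Proof.
move=> /nil_avoider h0; apply: uniq_perm.
- exact: uniq_descendants h0.
- by rewrite filter_uniq ?permutations_uniq.
move=> b; rewrite (mem_descendants _ _ h0) add0n; case: (boolP (b \in _)) => //= hb.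
rewrite (_ : filter _ _ = [::]) ?eqxx //; apply/eqP; rewrite -(negbK (_ == _)) -has_filter.
apply/hasPn => x; move: hb; rewrite mem_avoiders => /andP [/perm_mem -> _].
by rewrite mem_iota -ltnNge => /andP[].
Qed.

Hypothesis act1 : forall n a, a \in avoiders P n -> active P a 1.
Hypothesis ins1 : forall n a, a \in avoiders P n ->
  1 < nb_active P (insert a 1).

(* The two bounds are proved together: a single child is the first one, hence
   satisfies the stronger bound, which makes up for its parent. *)
Lemma nb_nodes_descendants d n a : a \in avoiders P n ->
  nb_nodes d a + 2 <= 4 * size (descendants d a) /\
  (1 < nb_active P a -> nb_nodes d a + 3 <= 4 * size (descendants d a)).
Proof.
elim: d n a => //= d IHd n a ha.
have : 0 < nb_active P a by have := act1 ha; rewrite (activeE _ rj ha) => /andP[].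
have := @child_avoider n a ^~ ha.
case: (nb_active P a) => // k hc _ /=.
have h1 : insert a 1 \in avoiders P n.+1 by apply: hc; rewrite inE.
have [_ /(_ (ins1 ha)) hd1] := IHd _ _ h1.
have sib s : {in s, forall i, insert a i \in avoiders P n.+1} ->
    sumn [seq nb_nodes d (insert a i) | i <- s] + 2 * size s <=
    4 * size (flatten [seq descendants d (insert a i) | i <- s]).
  elim: s => //= i s IHs hs; rewrite size_cat.
  have [hi _] := IHd _ _ (hs _ (mem_head _ _)).
  have := IHs (fun j js => hs j (mem_behead (s := i :: s) js)); lia.
have /sib : {in iota 2 k, forall i, insert a i \in avoiders P n.+1}.
  by move=> i hi; apply: hc; rewrite inE hi orbT.
rewrite size_iota.
(* The first child leaves a surplus of 3, the root uses 1 of it, and each of the [k] other children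
   adds 2. *)
rewrite size_cat; split=> [|k1]; lia.
Qed.

End Avoiders.

(** * Output and running time of the algorithm, for arbitrary labels *)

Section Algorithm.

Variables (C : costs) (P : set (seq nat)).
Variables (L : Type) (sites : L -> nat) (child : nat -> L -> L).
Variables (t : nat -> L -> nat) (label : seq nat -> L) (K : nat).

Hypothesis rj : right_justified P.
Hypothesis act1 : forall n a, a \in avoiders P n -> active P a 1.
Hypothesis sitesE : forall n a, a \in avoiders P n ->
  sites (label a) = nb_active P a.
Hypothesis childE : forall n a i, a \in avoiders P n ->
  1 <= i <= nb_active P a -> child i (label a) = label (insert a i).
Hypothesis t_le : forall n a i, a \in avoiders P n ->
  1 <= i <= nb_active P a -> t i (label a) <= K.

(** Per child, a parent evaluates the succession function and makes at most one step of each loop.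
    [c_node] adds the cost of a call proper and the exit tests of the two loops. *)
Let c_site := K + 2 * (cost_test C + cost_swap C).
Let c_node := c_site + cost_call C + cost_output C + cost_incr C +
  cost_write C + 2 * cost_test C.

Lemma array_swap u x y v q st : array st = u ++ [:: x, y & v] ->
  q = (size u).+1 -> array (swap C q.+1 q st) = u ++ [:: y, x & v].
Proof.
move=> stE -> /=; rewrite stE; elim: u {stE} => //= z u -> //.
Qed.

(** [behead] covers both cases: the first stale value is overwritten, or [s] is empty and the array
    grows. *)
Lemma array_write a s l st : array st = a ++ s -> l = (size a).+1 ->
  array (write C l l st) = a ++ l :: behead s.
Proof.
move=> stE lE; rewrite /= stE {1}lE /=.
by elim: a {stE lE} => [|z a /= ->] //; case: s.
Qed.

(** The same swap serves both loops: it moves the maximum left in the first and back right in the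
    second. *)
Lemma array_swap_insert a s i l st : 1 <= i <= size a -> l = (size a).+1 ->
  (array st = insert a i ++ s ->
     array (swap C (l - i.+1 + 2) (l - i.+1 + 1) st) = insert a i.+1 ++ s) /\
  (array st = insert a i.+1 ++ s ->
     array (swap C (l - i.+1 + 2) (l - i.+1 + 1) st) = insert a i ++ s).
Proof.
move=> hi ->; have [u [x [v [aE sv -> ->]]]] := insert_adjacent hi.
have qE : (size a).+1 - i.+1 + 1 = (size u).+1.
  by rewrite subSS aE size_cat /= sv; lia.
by rewrite addnS qE -!catA !cat_cons; split=> /array_swap; apply.
Qed.

Lemma for_loop_rcons r i body st :
  for_loop C (rcons r i) body st =
  body i (tick (cost_test C) (for_loop C r body st)).
Proof. by rewrite /for_loop foldl_rcons. Qed.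

Lemma unwind_loop a s l m st : m <= size a -> l = (size a).+1 ->
  array st = insert a m.+1 ++ s ->
  let st' := for_loop C (rev (iota 2 m))
    (fun i st => swap C (l - i + 2) (l - i + 1) st) st in
  [/\ array st' = insert a 1 ++ s, output st' = output st
    & time st' = time st + cost_test C + m * (cost_test C + cost_swap C)].
Proof.
rewrite /for_loop => hm lE stE /=.
(* The exit test is absorbed into the initial state, so that the induction concerns the fold
   alone. *)
set st1 := tick _ st; rewrite -[time st + _]/(time st1).
rewrite -[output st]/(output st1); have {stE} : array st1 = insert a m.+1 ++ s by [].
elim: m st1 hm => [|m IHm] st1 hm st1E; first by rewrite /= addn0.
rewrite iota_rcons rev_rcons /= !add2n.
have [] := IHm (swap C (l - m.+2 + 2) (l - m.+2 + 1) (tick (cost_test C) st1)).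
- exact: ltnW.
- by apply: (array_swap_insert s (i := m.+1) _ _ lE).2.
by move=> -> -> ->; split=> //=; rewrite mulSn; lia.
Qed.

(* The cells beyond a hold stale values. Charging c_site to a child in
   advance, hence the term on the left, covers the loops of its parent. *)
Lemma gen_avoid_recP d n a s st : a \in avoiders P n -> array st = a ++ s ->
  size s <= d ->
  let st' := gen_avoid_rec C sites child t d n (label a) st in
  [/\ exists2 s', array st' = a ++ s' & size s' <= d,
      output st' = output st ++ descendants P d a
    & time st' + c_site <= time st + c_node * nb_nodes P d a].
Proof.
elim: d n a s st => [|d IHd] n a s st ha stE.
  (* With no level left there is no stale cell, so the array output is exactly [a]. *)
  rewrite leqn0 => /nilP s0; rewrite {s}s0 in stE *; split=> /=.
  - by exists [::].
  - by rewrite stE cats0 cats1.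
  - by rewrite /c_node; lia.
move=> ss /=; rewrite (sitesE ha).
pose visit i st :=
  gen_avoid_rec C sites child t d n.+1 (child i (label a)) (tick (t i (label a)) st).
set k := nb_active P a.
have k_gt0 : 0 < k by have := act1 ha; rewrite (activeE _ rj ha) => /andP[].
have sa := avoider_size ha.
have k_le : k <= n.+1 by rewrite -sa nb_active_le.
have visitP i s1 st1 : 1 <= i <= k -> array st1 = insert a i ++ s1 -> size s1 <= d ->
  [/\ exists2 s', array (visit i st1) = insert a i ++ s' & size s' <= d,
      output (visit i st1) = output st1 ++ descendants P d (insert a i)
    & time (visit i st1) + c_site <=
      time st1 + K + c_node * nb_nodes P d (insert a i)].
  move=> hi st1E ss1; rewrite /visit (childE ha hi).
  have hc : insert a i \in avoiders P n.+1.
    by apply: (active_insert ha); rewrite (activeE _ rj ha).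
  have [] := IHd _ _ s1 (tick (t i (label a)) st1) hc st1E ss1.
  move=> h1 h2 h3; split=> //; apply: leq_trans h3 _ => /=.
  by rewrite leq_add2r leq_add2l (t_le ha hi).
set st0 := write C n.+1 n.+1 _; rewrite -/(visit 1 st0).
have st0E : array st0 = insert a 1 ++ behead s.
  rewrite insert1 sa cat_rcons; apply: array_write; last by rewrite sa.
  exact: stE.
have ss0 : size (behead s) <= d by rewrite size_behead; lia.
have o0 : output st0 = output st by [].
have t0 : time st0 = time st + cost_call C + cost_incr C + cost_write C by [].
pose body i st := visit i (swap C (n.+1 - i + 2) (n.+1 - i + 1) st).
(* Invariant after visiting sites 1 to [m.+1]. The term with factor [m] prepays the restoring swaps;
   the last one is the credit left from the first child after the exit test of this loop. *)
have loopP m : m < k -> let st1 := for_loop C (iota 2 m) body (visit 1 st0) in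
  [/\ exists2 s', array st1 = insert a m.+1 ++ s' & size s' <= d,
      output st1 = output st ++
        flatten [seq descendants P d (insert a i) | i <- iota 1 m.+1]
    & time st1 + m * (cost_test C + cost_swap C) + (cost_test C + 2 * cost_swap C) <=
      time st0 + c_node *
        sumn [seq nb_nodes P d (insert a i) | i <- iota 1 m.+1]].
  elim: m => [|m IHm] hm.
    have [] := visitP 1 (behead s) st0 _ st0E ss0; first by rewrite k_gt0.
    move=> h1 h2 h3; split=> //=; first by rewrite h2 cats0.
    by rewrite addn0; move: h3; rewrite /c_site; lia.
  have {IHm} := IHm (ltnW hm); rewrite (iota_rcons 2) for_loop_rcons [2 + m]add2n.
  set st1 := for_loop _ _ _ _ => -[[s' st1E ss'] o1 t1].
  have hmn : 1 <= m.+1 <= size a by rewrite sa; lia.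
  have := array_swap_insert s' (tick (cost_test C) st1) hmn erefl.
  rewrite sa => -[/(_ st1E) st2E _].
  have [|h1 h2 h3] := visitP m.+2 s' _ _ st2E ss'; first by rewrite hm.
  rewrite (iota_rcons 1 m.+1) add1n !map_rcons flatten_rcons sumn_rcons.
  split=> //.
    by rewrite h2 /= o1 catA.
  move: h3 t1; rewrite /body /c_site mulSn mulnDr /=; lia.
have := loopP k.-1; rewrite prednK // => /(_ (leqnn _)).
set st1 := for_loop _ _ _ _ => -[[s' st1E ss'] o1 t1].
have [|||] := @unwind_loop a s' n.+1 k.-1 st1; rewrite ?prednK ?sa //.
  lia.
set st2 := for_loop _ _ _ _ => st2E o2 t2.
split; last 2 first.
- by rewrite o2 o1.
- move: t2 t1 t0; rewrite /c_node /c_site mulnS; lia.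
(* Once restored to the last cell, n+1 becomes a stale value for the caller. *)
by exists (n.+1 :: s') => //; rewrite st2E insert1 sa cat_rcons.
Qed.

Lemma generates_in_CAT_rec x : pattern_set P ->
  (forall n a, a \in avoiders P n -> 1 < nb_active P (insert a 1)) ->
  x = label [::] ->
  generates_in_CAT P (fun n =>
    gen_avoid_rec C sites child t n 0 x (State [::] [::] 0)).
Proof.
move=> hP ins1 ->; have h0 := nil_avoider hP.
have recP n := @gen_avoid_recP n 0 [::] [::] (State [::] [::] 0) h0 erefl (leq0n n).
split=> [n|].
  by have [_ -> _] := recP n; apply: perm_descendants_nil.
(* The factor 4 bounds the number of nodes by the number of leaves. *)
exists (c_node * 4) => n; have [_ _ /= tn] := recP n.
rewrite -(perm_size (perm_descendants_nil rj n hP)) -mulnA.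
apply: leq_trans (leq_addr _ _) (leq_trans tn _).
rewrite add0n leq_mul2l; apply/orP; right.
have [hn _] := nb_nodes_descendants rj act1 ins1 n h0.
exact: leq_trans (leq_addr _ _) hn.
Qed.

End Algorithm.

(** * The regular and colored regular cases, as two choices of labels *)

Theorem theorem4 (P : set (seq nat)) (hP : pattern_set P)
    (hend : forall tau : seq nat,
       ~ P (tau ++ [:: (size tau).+2; (size tau).+1])) :
  (forall (chi : nat -> nat -> nat) (t : nat -> nat -> nat),
     regular P chi -> constant_time P t ->
     forall C : costs, generates_in_CAT P (gen_avoid C chi t)) /\
  (forall (color : seq nat -> int) (chi : nat -> nat -> int -> nat * int)
          (t : nat -> nat -> int -> nat),
     colored_regular P color chi -> colored_constant_time P color t ->
     forall C : costs, generates_in_CAT P (gen_avoid_colored C chi t)).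
Proof.
have h0 := nil_avoider hP.
split=> [chi t [rj reg] [K tK] C | color chi t [rj col0 reg] [K tK] C].
  have act1 n a ha := (reg n a ha).1.
  apply: (@generates_in_CAT_rec C P nat id chi t (nb_active P) K) => //.
  - by move=> n a i ha hi; rewrite ((reg n a ha).2 i hi).
  - by move=> n a; apply: nb_active_insert1.
  - by rewrite (nb_active_nil (act1 _ _ h0)).
have act1 n a ha := (reg n a ha).1.
apply: (@generates_in_CAT_rec C P (nat * int) fst (fun i x => chi i x.1 x.2)
  (fun i x => t i x.1 x.2) (fun a => (nb_active P a, color a)) K) => //=.
- by move=> n a i ha hi; rewrite -((reg n a ha).2 i hi).
- by move=> n a; apply: nb_active_insert1.
- by rewrite (nb_active_nil (act1 _ _ h0)) col0.
Qed.
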